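(* Let $\ell\in\mathbb{Z}$ and $m\in\{0,1,2,\ldots\}$ with $m\ge\ell$. For all $x\in\mathbb{R}$, $$I_1\!\left(\frac{\ell}{2},\,m+\frac{1-\ell}{2};\,x\right)=e^{x}\,\mathcal{F}(-\ell,m-\ell,-x)-\mathcal{F}(\ell,m,x).$$
   Context: $I_1(\kappa,\mu;x)=\int_0^1 e^{xt}t^{\mu-\kappa-1/2}(1-t)^{\mu+\kappa-1/2}\ln\left(\frac{1-t}{t}\right)dt$, so that here $I_1\!\left(\frac{\ell}{2},m+\frac{1-\ell}{2};x\right)=\int_0^1 e^{xt}t^{m-\ell}(1-t)^{m}\ln\left(\frac{1-t}{t}\right)dt$. For integers $s,k$ with $k\ge0$ and $k\ge s$, $$\mathcal{F}(s,k,z)=\sum_{n=0}^{k}(-1)^n\binom{k}{n}\frac{d^{\,n+k-s}}{dz^{\,n+k-s}}\left[\frac{\ln z-\mathrm{Chi}(z)-\mathrm{Shi}(z)+\gamma}{z}\right],$$ where $\gamma$ is Euler's constant, $\mathrm{Shi}(z)=\int_0^z\frac{\sinh t}{t}dt$ and $\mathrm{Chi}(z)=\gamma+\ln z+\int_0^z\frac{\cosh t-1}{t}dt$ (same branch of $\ln z$ in both places). The bracketed function extends to an entire function of $z$, and $\mathcal{F}(s,k,0)$ is understood through this extension. *)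

(* Defs.v *)
From Stdlib Require Import Reals ZArith.
From Coquelicot Require Import Coquelicot.

Open Scope R_scope.

(* The endpoint singularities, and the values of the integrand outside ]0,1[,
   are handled by taking the integral as improper at both ends. *)
Definition I1_integrand (kappa mu x : R) (t : R) : R :=
  exp (x * t) * Rpower t (mu - kappa - 1/2) * Rpower (1 - t) (mu + kappa - 1/2)
  * ln ((1 - t) / t).

Definition I1 (kappa mu x : R) : R :=
  RInt_gen (I1_integrand kappa mu x) (at_right 0) (at_left 1).

Definition Euler_gamma : R :=
  Lim_seq (fun n : nat => sum_n_m (fun k => / INR k) 1 n - ln (INR n)).

Local Open Scope C_scope.

Definition Cexp (z : C) : C := (exp (Re z) * cos (Im z), exp (Re z) * sin (Im z))%R.
Definition Csinh (z : C) : C := (Cexp z - Cexp (- z)) / 2.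
Definition Ccosh (z : C) : C := (Cexp z + Cexp (- z)) / 2.

(* Any determination of the logarithm, principal or not; nothing is required
   at 0, and no regularity is required. *)
Definition is_Clog (lg : C -> C) : Prop :=
  forall z : C, z <> 0 -> Cexp (lg z) = z.

(* Integral along the segment from 0 to z. A removable singularity of f at 0
   is harmless, since [RInt] does not depend on the values at the endpoints. *)
Definition CInt0 (f : C -> C) (z : C) : C :=
  z * RInt (V := C_R_CompleteNormedModule) (fun u : R => f (u * z)) 0 1.

Definition Shi (z : C) : C := CInt0 (fun t => Csinh t / t) z.

Definition Chi (lg : C -> C) (z : C) : C :=
  Euler_gamma + lg z + CInt0 (fun t => (Ccosh t - 1) / t) z.

(* Limits and derivatives in the full complex sense; Coquelicot's total
   operators [C_lim] and [C_derive] only look along the horizontal line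
   through z. *)
Definition Clim (f : C -> C) (z : C) : C :=
  iota (T := C_CompleteNormedModule)
    (fun l : C => filterlim f (locally' z) (locally l)).

Definition Cderiv (f : C -> C) (z : C) : C :=
  iota (T := C_CompleteNormedModule) (fun l : C => is_derive f z l).

Definition Cderiv_n (n : nat) (f : C -> C) : C -> C := Nat.iter n Cderiv f.

Definition bracket (lg : C -> C) (z : C) : C :=
  (lg z - Chi lg z - Shi z + Euler_gamma) / z.

Definition bracket_ext (lg : C -> C) (z : C) : C :=
  if Ceq_dec z 0 then Clim (bracket lg) 0 else bracket lg z.

(* Meaningful for 0 <= k and s <= k, so that both uses of [Z.to_nat] are exact. *)
Definition calF (lg : C -> C) (s k : Z) (z : C) : C :=
  sum_n (fun n : nat =>
           (-1) ^ n * Binomial.C (Z.to_nat k) n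
           * Cderiv_n (Z.to_nat (Z.of_nat n + k - s)) (bracket_ext lg) z)
        (Z.to_nat k).

(* Main.v *)
Require Import Defs.
From Stdlib Require Import Reals ZArith Lra Lia FunctionalExtensionality.
From Coquelicot Require Import Coquelicot.

(* The bracketed function is [B(z) = - int_0^1 (exp(u z) - 1) / (u z) du], whatever the
   logarithm, and an integration by parts turns it into [int_0^1 exp(z t) ln t dt].
   Differentiating under the integral and summing with the binomial theorem gives
   [F(s, k, z) = int_0^1 exp(z t) t^(k - s) (1 - t)^k ln t dt]. With [t -> 1 - t] in
   the first of the two terms, the right-hand side becomes the integral of
   [exp(x t) t^(m - l) (1 - t)^m (ln (1 - t) - ln t)].
   All integrals against [ln t] are made proper by the substitution [t = u^2]. *)

(** * Bounds on the logarithm and continuity of [t ln t] *)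

Lemma ln_neg (t : R) : t <= 0 -> ln t = 0.
Proof. intros Ht; unfold ln; destruct (Rlt_dec 0 t) as [H|H]; [exfalso; lra | easy]. Qed.

Lemma ln_ge (t : R) : 0 < t -> 1 - / t <= ln t.
Proof.
intros Ht.
assert (H := exp_ineq1_le (ln (/ t))).
rewrite exp_ln in H by now apply Rinv_0_lt_compat.
rewrite ln_Rinv in H by easy.
lra.
Qed.

(** With [s = sqrt t], [t ln t = 2 s^2 ln s], and [ln s >= 1 - 1 / s] gives
    [s^2 ln s >= s^2 - s >= -s]. *)
Lemma xlnx_bound (t : R) : 0 <= t <= 1 -> Rabs (t * ln t) <= 2 * sqrt t.
Proof.
intros [[Ht|<-] Ht1].
2: rewrite Rmult_0_l, Rabs_R0, sqrt_0; lra.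
assert (Hs : 0 < sqrt t) by now apply sqrt_lt_R0.
assert (Hss := sqrt_sqrt t (Rlt_le _ _ Ht)).
assert (Hl : ln t <= 0) by (rewrite <- ln_1; apply ln_le; lra).
assert (E : ln t = 2 * ln (sqrt t)) by (rewrite <- Hss at 1; rewrite ln_mult by easy; ring).
assert (H := ln_ge _ Hs).
rewrite Rabs_left1 by nra.
assert (sqrt t * / sqrt t = 1) by (field; lra).
assert (sqrt t * sqrt t * (1 - / sqrt t) <= sqrt t * sqrt t * ln (sqrt t)).
{ apply Rmult_le_compat_l; nra. }
replace (sqrt t * sqrt t * (1 - / sqrt t)) with (sqrt t * sqrt t - sqrt t) in H1 by (field; lra).
rewrite Hss in H1. rewrite E. lra.
Qed.

(** Continuity on the whole line, thanks to the default value [ln t = 0] for [t <= 0], spares side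
    conditions on all the integrands below. *)
Lemma continuous_xlnx (x : R) : continuous (fun t : R => t * ln t) x.
Proof.
destruct (total_order_T x 0) as [[Hx| ->]|Hx].
- apply continuous_ext_loc with (fun _ : R => 0).
  + exists (mkposreal (- x) ltac:(lra)); intros y Hy.
    apply Rabs_lt_between' in Hy; cbn in Hy.
    rewrite ln_neg; lra.
  + apply continuous_const.
- apply continuity_pt_filterlim; intros eps Heps.
  (* For [0 < y < (eps / 2)^2] the bound [2 sqrt y] is less than [eps]; the minimum with 1 is what
     [xlnx_bound] requires. *)
  exists (Rmin 1 (Rsqr (eps / 2))); split.
  { apply Rmin_pos; [lra|]. apply Rlt_0_sqr; lra. }
  intros y [_ Hy]; cbn in Hy |- *; unfold Rdist in *.
  rewrite Rminus_0_r in Hy.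
  replace (y * ln y - 0 * ln 0) with (y * ln y) by ring.
  destruct (Rle_dec y 0) as [H|H].
  { rewrite ln_neg, Rmult_0_r, Rabs_R0 by easy. lra. }
  rewrite Rabs_pos_eq in Hy by lra.
  assert (H1 := Rmin_l 1 (Rsqr (eps / 2))).
  assert (H2 := Rmin_r 1 (Rsqr (eps / 2))).
  apply Rle_lt_trans with (2 * sqrt y).
  { apply xlnx_bound; lra. }
  assert (sqrt y < sqrt (Rsqr (eps / 2))) by (apply sqrt_lt_1; lra).
  rewrite sqrt_Rsqr in H0 by lra. lra.
- apply (ex_derive_continuous (fun t : R => t * ln t)). auto_derive; lra.
Qed.

(** * Integrals against the logarithm, as proper integrals *)

Definition logker (f : R -> R) (u : R) : R := 4 * (u * ln u) * f (u ^ 2).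

(* Stands for [int_0^1 f t * ln t dt], after [t = u^2]. *)
Definition logint (f : R -> R) : R := RInt (logker f) 0 1.

Lemma continuous_sqr (x : R) : continuous (fun u : R => u ^ 2) x.
Proof. apply (ex_derive_continuous (fun u : R => u ^ 2)); auto_derive; auto. Qed.

Lemma continuous_logker (f : R -> R) (u : R) :
  (forall t, continuous f t) -> continuous (logker f) u.
Proof.
intros Hf.
apply (continuous_mult (fun u : R => 4 * (u * ln u)) (fun u : R => f (u ^ 2))).
- apply (continuous_scal_r 4 (fun u : R => u * ln u)), continuous_xlnx.
- apply (continuous_comp (fun u : R => u ^ 2)); [apply continuous_sqr | apply Hf].
Qed.

Lemma is_RInt_logint (f : R -> R) :
  (forall t, continuous f t) -> is_RInt (logker f) 0 1 (logint f).
Proof.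
intros Hf; apply (RInt_correct (logker f)), (ex_RInt_continuous (logker f)).
intros u _; now apply continuous_logker.
Qed.

Lemma logint_ext (f g : R -> R) : (forall t, f t = g t) -> logint f = logint g.
Proof. intros H; apply RInt_ext; intros u _; unfold logker; now rewrite H. Qed.

Lemma logint_plus (f g : R -> R) :
  (forall t, continuous f t) -> (forall t, continuous g t) ->
  logint (fun t => f t + g t) = logint f + logint g.
Proof.
intros Hf Hg; apply is_RInt_unique.
apply (is_RInt_ext (fun u => plus (logker f u) (logker g u))).
- intros u _; unfold logker, plus; cbn -[pow]; ring.
- apply (is_RInt_plus (logker f) (logker g)); now apply is_RInt_logint.
Qed.

Lemma logint_scal (c : R) (f : R -> R) :
  (forall t, continuous f t) -> logint (fun t => c * f t) = c * logint f.
Proof.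
intros Hf; apply is_RInt_unique.
apply (is_RInt_ext (fun u => scal c (logker f u))).
- intros u _; unfold logker, scal; cbn -[pow]; unfold mult; cbn -[pow]; ring.
- apply (is_RInt_scal (logker f)); now apply is_RInt_logint.
Qed.

(** The weight [4 (u ln u)] is [ln (u^2)] times the Jacobian [2 u]. On [[0, 1]] its absolute value
    is at most [4 * 2], by [xlnx_bound]. *)
Lemma logint_bound (f : R -> R) (M : R) :
  (forall t, continuous f t) -> (forall t, 0 <= t <= 1 -> Rabs (f t) <= M) ->
  Rabs (logint f) <= 8 * M.
Proof.
intros Hf HM.
apply (norm_RInt_le (V := R_NormedModule) (logker f) (fun _ => 8 * M) 0 1); [lra| |now apply is_RInt_logint|].
2:{ replace (8 * M) with ((1 - 0) * (8 * M)) at 1 by ring.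
    exact (is_RInt_const (V := R_NormedModule) 0 1 (8 * M)). }
intros u Hu; unfold norm; cbn -[pow]; unfold abs; cbn -[pow]; unfold logker.
rewrite !Rabs_mult, (Rabs_pos_eq 4) by lra; rewrite <- Rabs_mult.
assert (Rabs (f (u ^ 2)) <= M) by (apply HM; nra).
assert (Rabs (u * ln u) <= 2).
{ apply Rle_trans with (1 := xlnx_bound u Hu).
  assert (sqrt u <= sqrt 1) by (apply sqrt_le_1; lra). rewrite sqrt_1 in *; lra. }
assert (H1 := Rabs_pos (f (u ^ 2))). assert (H2 := Rabs_pos (u * ln u)).
nra.
Qed.

(** * Integration by parts against the logarithm *)

Lemma is_derive_id_mult (c : R -> R) :
  continuous c 0 -> is_derive (fun h => h * c h) 0 (c 0).
Proof.
intros Hc; apply is_derive_Reals.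
apply continuity_pt_filterlim in Hc.
intros eps Heps; destruct (Hc eps Heps) as [d [Hd H]].
exists (mkposreal d Hd); intros h Hh Hhd; cbn in Hhd.
replace (((0 + h) * c (0 + h) - 0 * c 0) / h - c 0) with (c h - c 0)
  by (rewrite Rplus_0_l; field; easy).
apply (H h); split.
- split; [exact I | now apply not_eq_sym].
- cbn; unfold Rdist; now rewrite Rminus_0_r.
Qed.

(** Meant for [P 0 = 0] with [P'] the derivative of [P]: the removable singularity of [P t / t] is
    then filled with its limit. *)
Definition quot0 (P P' : R -> R) (t : R) : R := if Req_dec_T t 0 then P' 0 else P t / t.

Lemma continuous_quot0 (P P' : R -> R) (t : R) :
  (forall t, is_derive P t (P' t)) -> P 0 = 0 -> continuous (quot0 P P') t.
Proof.
intros HP H0; destruct (Req_dec_T t 0) as [->|Ht].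
- apply continuity_pt_filterlim; intros eps Heps.
  assert (HD := HP 0); apply is_derive_Reals in HD.
  destruct (HD eps Heps) as [d H]; exists d; split; [apply cond_pos|].
  intros h [[_ Hh] Hd]; cbn in Hd |- *; unfold Rdist in *.
  unfold quot0; destruct (Req_dec_T 0 0) as [_|]; [|easy].
  destruct (Req_dec_T h 0) as [->|Hh0]; [easy|].
  rewrite Rminus_0_r in Hd.
  specialize (H h Hh0 Hd); now rewrite Rplus_0_l, H0, Rminus_0_r in H.
- apply continuous_ext_loc with (fun t => P t / t).
  + assert (Ha := Rabs_pos_lt t Ht).
    exists (mkposreal _ Ha); intros y Hy.
    unfold quot0; destruct (Req_dec_T y 0) as [->|]; [|easy].
    change (Rabs (0 - t) < Rabs t) in Hy. rewrite Rminus_0_l, Rabs_Ropp in Hy; lra.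
  + apply (ex_derive_continuous (fun t => P t / t)).
    assert (ex_derive P t) by (eexists; apply HP). auto_derive; auto.
Qed.

(* Integration by parts: in the variable [u], [2 ln u * P (u^2)] is a primitive
   of [logker P' u + 2 P (u^2) / u] that vanishes at both ends. *)
Lemma is_RInt_quot (P P' : R -> R) :
  (forall t, is_derive P t (P' t)) -> (forall t, continuous P' t) -> P 0 = 0 ->
  is_RInt (fun t => P t / t) 0 1 (- logint P').
Proof.
intros HP HP' H0.
set (Q := quot0 P P').
assert (HQ : forall t, continuous Q t) by (intros; now apply continuous_quot0).
apply (is_RInt_ext Q).
{ rewrite Rmin_left by lra; intros t Ht; unfold Q, quot0; destruct (Req_dec_T t 0); [lra|easy]. }
assert (HI : is_RInt Q 0 1 (RInt Q 0 1)).
{ apply (RInt_correct Q), (ex_RInt_continuous Q); intros; apply HQ. }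
assert (HC : is_RInt (fun u => 2 * u * Q (u ^ 2)) 0 1 (RInt Q 0 1)).
{ assert (H := is_RInt_comp Q (fun u => u ^ 2) (fun u => 2 * u) 0 1).
  cbn -[pow] in H. replace (0 ^ 2) with 0 in H by ring. replace (1 ^ 2) with 1 in H by ring.
  apply H.
  - intros; apply HQ.
  - intros u _; split.
    + auto_derive; auto; ring.
    + apply (ex_derive_continuous (fun u : R => 2 * u)); auto_derive; auto. }
(* Since [P (u^2) = u^2 Q (u^2)], the primitive [2 ln u * P (u^2)] equals [u * c u] for [u > 0], and
   in this form it makes sense at 0. *)
set (c := fun u => 2 * (u * ln u) * Q (u ^ 2)).
assert (Hc : forall u, continuous c u).
{ intros u; apply (continuous_mult (fun u : R => 2 * (u * ln u)) (fun u : R => Q (u ^ 2))).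
  - apply (continuous_scal_r 2 (fun u : R => u * ln u)), continuous_xlnx.
  - apply (continuous_comp (fun u : R => u ^ 2)); [apply continuous_sqr | apply HQ]. }
assert (HQd : forall t, t * Q t = P t).
{ intros t; unfold Q, quot0; destruct (Req_dec_T t 0) as [->|]; [lra|now field]. }
set (d := fun u => plus (logker P' u) (2 * u * Q (u ^ 2))).
assert (Hdc : forall u, continuous d u).
{ intros u; apply (continuous_plus (logker P')).
  - now apply continuous_logker.
  - apply (continuous_mult (fun u : R => 2 * u) (fun u : R => Q (u ^ 2))).
    + apply (ex_derive_continuous (fun u : R => 2 * u)); auto_derive; auto.
    + apply (continuous_comp (fun u : R => u ^ 2)); [apply continuous_sqr | apply HQ]. }
assert (HD : is_RInt d 0 1 (minus (1 * c 1) (0 * c 0))).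
(* For [u > 0] the derivative is computed from the logarithmic form. At 0, where [ln] is not
   differentiable, continuity of [c] suffices, and the derivative is [c 0 = 0 = d 0]. *)
{ apply (is_RInt_derive (fun u => u * c u)); intros u; [|intros; apply Hdc].
  rewrite Rmin_left, Rmax_right by lra; intros [[Hu|<-] _].
  - assert (HPu := HP (u ^ 2)).
    apply (is_derive_ext_loc (fun u => 2 * ln u * P (u ^ 2))).
    + exists (mkposreal u Hu); intros y Hy.
      change (@eq R (2 * ln y * P (y ^ 2)) (y * (2 * (y * ln y) * Q (y ^ 2)))).
      rewrite <- HQd; ring.
    + assert (ex_derive P (u ^ 2)) by (eexists; apply HP).
      assert (E : Derive P (u ^ 2) = P' (u ^ 2)) by now apply is_derive_unique.
      auto_derive; [repeat split; auto|]. unfold d, plus, logker; cbn -[pow].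
      change (Derive (fun x : R => P x)) with (Derive P). cbn [pow] in E |- *. rewrite E.
      rewrite <- (HQd (u * (u * 1))). field. lra.
  - replace (d 0) with (c 0); [apply is_derive_id_mult, Hc|].
    unfold d, c, logker, plus; cbn; ring. }
assert (HD' : is_RInt d 0 1 (plus (logint P') (RInt Q 0 1))).
{ apply (is_RInt_plus (logker P')); [now apply is_RInt_logint|easy]. }
(* The boundary terms vanish, by [ln 1 = 0] at 1 and by the factor 0 at 0, so the two integrals
   composing that of [d] are opposite. *)
assert (E := eq_trans (eq_sym (is_RInt_unique _ _ _ _ HD)) (is_RInt_unique _ _ _ _ HD')).
change (1 * c 1 - 0 * c 0 = logint P' + RInt Q 0 1) in E; unfold c in E; rewrite ln_1 in E.
replace (- logint P') with (RInt Q 0 1) by lra.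
exact HI.
Qed.

(** * Moments of the complex exponential against the logarithm *)

Definition ecos (z : C) (t : R) : R := exp (Re z * t) * cos (Im z * t).
Definition esin (z : C) (t : R) : R := exp (Re z * t) * sin (Im z * t).

Lemma continuous_pow_mult (j : nat) (f : R -> R) (t : R) :
  (forall t, continuous f t) -> continuous (fun t => t ^ j * f t) t.
Proof.
intros Hf; apply (continuous_mult (fun t : R => t ^ j) f); [|apply Hf].
apply (ex_derive_continuous (fun t : R => t ^ j)); auto_derive; auto.
Qed.

Lemma continuous_ecos (z : C) (t : R) : continuous (ecos z) t.
Proof. apply (ex_derive_continuous (ecos z)); unfold ecos; auto_derive; auto. Qed.

Lemma continuous_esin (z : C) (t : R) : continuous (esin z) t.
Proof. apply (ex_derive_continuous (esin z)); unfold esin; auto_derive; auto. Qed.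

(** This is [int_0^1 t^j exp(z t) ln t dt], given by its real and imaginary parts so that only real
    integrals are handled. *)
Definition logmoment (j : nat) (z : C) : C :=
  (logint (fun t => t ^ j * ecos z t), logint (fun t => t ^ j * esin z t)).

(** * Taylor bounds for the exponential, from the mean value theorem *)

Lemma exp_sub1_bound (a : R) : Rabs a <= 1 -> Rabs (exp a - 1) <= 3 * Rabs a.
Proof.
intros Ha.
destruct (MVT_gen exp 0 a exp) as [c [Hc E]].
- intros; auto_derive; auto; ring.
- intros; apply derivable_continuous_pt, derivable_pt_exp.
- rewrite exp_0, Rminus_0_r in E; rewrite E, Rabs_mult.
  apply Rmult_le_compat_r; [apply Rabs_pos|].
  rewrite Rabs_pos_eq by apply Rlt_le, exp_pos.
  apply Rle_trans with (2 := exp_le_3).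
  apply Rabs_le_between in Ha.
  assert (H : c <= 1) by (apply Rle_trans with (1 := proj2 Hc), Rmax_lub; lra).
  destruct H as [H| ->]; [apply Rlt_le, exp_increasing, H|lra].
Qed.

Lemma Rabs_between_0 (a c : R) : Rmin 0 a <= c <= Rmax 0 a -> Rabs c <= Rabs a.
Proof.
unfold Rmin, Rmax, Rabs; destruct (Rle_dec 0 a), (Rcase_abs c), (Rcase_abs a); lra.
Qed.

Lemma exp_sub_bound (a : R) : Rabs a <= 1 -> Rabs (exp a - 1 - a) <= 3 * a ^ 2.
Proof.
intros Ha.
destruct (MVT_gen (fun a => exp a - a) 0 a (fun c => exp c - 1)) as [c [Hc E]].
- intros; auto_derive; auto; ring.
- intros; apply continuity_pt_filterlim, (ex_derive_continuous (fun a => exp a - a)).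
  auto_derive; auto.
- replace (exp a - 1 - a) with ((exp c - 1) * (a - 0)) by (rewrite <- E, exp_0; ring).
  rewrite Rminus_0_r, Rabs_mult, <- pow2_abs.
  assert (H := Rabs_between_0 _ _ Hc).
  assert (H1 := exp_sub1_bound c ltac:(lra)).
  assert (H2 := Rabs_pos a). nra.
Qed.

Lemma sin_bound (a : R) : Rabs (sin a) <= Rabs a.
Proof.
destruct (MVT_gen sin 0 a cos) as [c [Hc E]].
- intros; auto_derive; auto; ring.
- intros; apply derivable_continuous_pt, derivable_pt_sin.
- rewrite sin_0, !Rminus_0_r in E; rewrite E, Rabs_mult.
  rewrite <- (Rmult_1_l (Rabs a)) at 2.
  apply Rmult_le_compat_r; [apply Rabs_pos|]. apply Rabs_le, COS_bound.
Qed.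

Lemma cos_sub1_bound (a : R) : Rabs (cos a - 1) <= a ^ 2.
Proof.
destruct (MVT_gen cos 0 a (fun c => - sin c)) as [c [Hc E]].
- intros; auto_derive; auto; ring.
- intros; apply derivable_continuous_pt, derivable_pt_cos.
- rewrite cos_0, !Rminus_0_r in E; rewrite E, Rabs_mult, Rabs_Ropp, <- pow2_abs.
  assert (H := Rabs_between_0 _ _ Hc). assert (H1 := sin_bound c). assert (H2 := Rabs_pos a). nra.
Qed.

Lemma sin_sub_bound (a : R) : Rabs a <= 1 -> Rabs (sin a - a) <= a ^ 2.
Proof.
intros Ha; destruct (MVT_gen (fun a => sin a - a) 0 a (fun c => cos c - 1)) as [c [Hc E]].
- intros; auto_derive; auto; ring.
- intros; apply continuity_pt_filterlim, (ex_derive_continuous (fun a => sin a - a)).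
  auto_derive; auto.
- rewrite sin_0, !Rminus_0_r in E; rewrite E, Rabs_mult, <- pow2_abs.
  assert (H := Rabs_between_0 _ _ Hc). assert (H1 := cos_sub1_bound c).
  rewrite <- pow2_abs in H1.
  assert (H2 := Rabs_pos a). assert (H3 := Rabs_pos c). nra.
Qed.

(** Together with [exp_sin_bound], this bounds [exp w - 1 - w] quadratically for the complex number
    [w = p + i q], one component at a time. *)
Lemma exp_cos_bound (p q : R) : Rabs p <= 1 -> Rabs q <= 1 ->
  Rabs (exp p * cos q - 1 - p) <= 4 * (p ^ 2 + q ^ 2).
Proof.
intros Hp Hq.
assert (H1 := exp_sub_bound p Hp). assert (H2 := cos_sub1_bound q).
assert (H3 := exp_sub1_bound p Hp).
assert (H4 : 0 < exp p <= 4).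
{ split; [apply exp_pos|]. apply Rabs_le_between in H3; lra. }
replace (exp p * cos q - 1 - p) with ((exp p - 1 - p) + exp p * (cos q - 1)) by ring.
apply Rle_trans with (1 := Rabs_triang _ _); rewrite Rabs_mult, (Rabs_pos_eq (exp p)) by lra.
assert (H5 := Rabs_pos (cos q - 1)). nra.
Qed.

Lemma exp_sin_bound (p q : R) : Rabs p <= 1 -> Rabs q <= 1 ->
  Rabs (exp p * sin q - q) <= 4 * (p ^ 2 + q ^ 2).
Proof.
intros Hp Hq.
assert (H1 := exp_sub1_bound p Hp). assert (H2 := sin_bound q). assert (H3 := sin_sub_bound q Hq).
replace (exp p * sin q - q) with ((exp p - 1) * sin q + (sin q - q)) by ring.
apply Rle_trans with (1 := Rabs_triang _ _); rewrite Rabs_mult.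
assert (Rabs (exp p - 1) * Rabs (sin q) <= 3 * Rabs p * Rabs q).
{ apply Rmult_le_compat; auto using Rabs_pos. }
rewrite <- (pow2_abs p), <- (pow2_abs q) in *. nra.
Qed.

(* The bound [|exp (z t) (exp (h t) - 1 - h t)| <= C |h|^2], real and imaginary parts. *)
Lemma exp_increment_bound (a b p q t : R) :
  0 <= t <= 1 -> Rabs p <= 1 -> Rabs q <= 1 ->
  Rabs (exp ((a + p) * t) * cos ((b + q) * t) - exp (a * t) * cos (b * t)
        - t * (p * (exp (a * t) * cos (b * t)) - q * (exp (a * t) * sin (b * t))))
    <= 8 * exp (Rabs a) * (p ^ 2 + q ^ 2) /\
  Rabs (exp ((a + p) * t) * sin ((b + q) * t) - exp (a * t) * sin (b * t)
        - t * (p * (exp (a * t) * sin (b * t)) + q * (exp (a * t) * cos (b * t))))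
    <= 8 * exp (Rabs a) * (p ^ 2 + q ^ 2).
Proof.
intros Ht Hp Hq.
assert (Hb : forall y, Rabs y <= 1 -> Rabs (y * t) <= 1).
{ intros y Hy; rewrite Rabs_mult, (Rabs_pos_eq t) by lra. assert (H := Rabs_pos y); nra. }
assert (HX := exp_cos_bound (p * t) (q * t) (Hb p Hp) (Hb q Hq)).
assert (HY := exp_sin_bound (p * t) (q * t) (Hb p Hp) (Hb q Hq)).
(* [X + i Y] is [exp(h t) - 1 - h t] for [h = p + i q]. Each is at most [4 (p^2 + q^2)] in absolute
   value. *)
set (X := exp (p * t) * cos (q * t) - 1 - p * t) in *.
set (Y := exp (p * t) * sin (q * t) - q * t) in *.
assert (Hs : (p * t) ^ 2 + (q * t) ^ 2 <= p ^ 2 + q ^ 2).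
{ assert (0 <= p ^ 2) by apply pow2_ge_0. assert (0 <= q ^ 2) by apply pow2_ge_0.
  assert (t ^ 2 <= 1) by nra. rewrite !Rpow_mult_distr. nra. }
assert (He : 0 < exp (a * t) <= exp (Rabs a)).
{ split; [apply exp_pos|].
  assert (Hle : a * t <= Rabs a).
  { apply Rle_trans with (1 := Rle_abs _); rewrite Rabs_mult, (Rabs_pos_eq t) by lra.
    assert (H := Rabs_pos a); nra. }
  destruct Hle as [H| ->]; [apply Rlt_le, exp_increasing, H|lra]. }
assert (Hc : Rabs (cos (b * t)) <= 1) by apply Rabs_le, COS_bound.
assert (Hsn : Rabs (sin (b * t)) <= 1) by apply Rabs_le, SIN_bound.
(* Both components of [exp(z t) (X + i Y)] have this shape, with [u] and [v] equal to sines and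
   cosines of [b t] up to sign. *)
assert (K : forall u v, Rabs u <= 1 -> Rabs v <= 1 ->
  Rabs (exp (a * t) * (u * X + v * Y)) <= 8 * exp (Rabs a) * (p ^ 2 + q ^ 2)).
{ intros u v Hu Hv; rewrite Rabs_mult, (Rabs_pos_eq (exp (a * t))) by lra.
  assert (Rabs (u * X + v * Y) <= 8 * (p ^ 2 + q ^ 2)).
  { apply Rle_trans with (1 := Rabs_triang _ _); rewrite !Rabs_mult.
    assert (H1 := Rabs_pos u). assert (H2 := Rabs_pos v).
    assert (H3 := Rabs_pos X). assert (H4 := Rabs_pos Y).
    assert (Rabs u * Rabs X <= 1 * Rabs X) by (apply Rmult_le_compat_r; lra).
    assert (Rabs v * Rabs Y <= 1 * Rabs Y) by (apply Rmult_le_compat_r; lra).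
    lra. }
  replace (8 * exp (Rabs a) * (p ^ 2 + q ^ 2)) with (exp (Rabs a) * (8 * (p ^ 2 + q ^ 2))) by ring.
  apply Rmult_le_compat; auto using Rabs_pos; lra. }
rewrite !Rmult_plus_distr_r, exp_plus, cos_plus, sin_plus; split.
- replace (_ - _ - _) with (exp (a * t) * (cos (b * t) * X + (- sin (b * t)) * Y))
    by (unfold X, Y; ring).
  apply K; [easy|now rewrite Rabs_Ropp].
- replace (_ - _ - _) with (exp (a * t) * (sin (b * t) * X + cos (b * t) * Y))
    by (unfold X, Y; ring).
  now apply K.
Qed.

(** * Complex differentiation under the integral sign *)

Lemma logint_pow_lin (j : nat) (f g h k : R -> R) (p q M : R) :
  (forall t, continuous f t) -> (forall t, continuous g t) ->
  (forall t, continuous h t) -> (forall t, continuous k t) ->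
  (forall t, 0 <= t <= 1 -> Rabs (f t - g t - t * (p * h t + q * k t)) <= M) ->
  Rabs (logint (fun t => t ^ j * f t) - logint (fun t => t ^ j * g t)
        - (p * logint (fun t => t ^ S j * h t) + q * logint (fun t => t ^ S j * k t))) <= 8 * M.
Proof.
intros Hf Hg Hh Hk HM.
assert (Cs : forall (c : R) (u : R -> R), (forall t, continuous u t) -> forall t, continuous (fun t => c * u t) t).
{ intros c u Hu t; apply (continuous_scal_r c u), Hu. }
assert (Cp : forall (u v : R -> R), (forall t, continuous u t) -> (forall t, continuous v t) -> forall t, continuous (fun t => u t + v t) t).
{ intros u v Hu Hv t; apply (continuous_plus u v); auto. }
assert (P := fun i u H t => continuous_pow_mult i u t H).
(* By linearity the left-hand side is a single integral. The factor [t] of the linear term is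
   absorbed into [t^(j+1)], and the remaining [t^j] is at most 1. *)
replace (_ - _ - _) with (logint (fun t => (t ^ j * f t + (-1) * (t ^ j * g t))
   + ((- p) * (t ^ S j * h t) + (- q) * (t ^ S j * k t)))).
2:{ rewrite !logint_plus, !logint_scal; auto 8. ring. }
apply logint_bound; [auto 8|].
intros t Ht; specialize (HM t Ht).
replace (_ + _) with (t ^ j * (f t - g t - t * (p * h t + q * k t))) by (cbn [pow]; ring).
rewrite Rabs_mult, (Rabs_pos_eq (t ^ j)) by (apply pow_le; lra).
assert (0 <= t ^ j <= 1) by (split; [apply pow_le|rewrite <- (pow1 j); apply pow_incr]; lra).
assert (H1 := Rabs_pos (f t - g t - t * (p * h t + q * k t))). nra.
Qed.

Lemma Cmod_le_Rabs (z : C) : Cmod z <= Rabs (fst z) + Rabs (snd z).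
Proof.
assert (H1 := Rabs_pos (fst z)). assert (H2 := Rabs_pos (snd z)).
unfold Cmod.
rewrite <- (sqrt_Rsqr (Rabs (fst z) + Rabs (snd z))) by lra.
apply sqrt_le_1_alt; unfold Rsqr; rewrite <- (pow2_abs (fst z)), <- (pow2_abs (snd z)); nra.
Qed.

(** The first-order remainder of the integrand is quadratic in the increment, uniformly for [t] in
    [[0, 1]], and this survives integration. *)
Lemma is_derive_logmoment (j : nat) (z : C) :
  is_derive (K := C_AbsRing) (V := C_NormedModule) (logmoment j) z (logmoment (S j) z).
Proof.
split; [apply is_linear_scal_l|].
intros y Hy; apply (is_filter_lim_locally_unique (K := C_AbsRing) (V := AbsRing_NormedModule C_AbsRing)) in Hy; subst y.
intros eps.
(* [128 = 2 * 8 * 8]: two components, the factor 8 of [logint_bound] and the 8 of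
   [exp_increment_bound]. The remainder is at most [K |h|^2], hence at most [eps |h|] once
   [|h| < eps / K]. *)
set (K := 128 * exp (Rabs (Re z))).
assert (HK : 0 < K) by (unfold K; assert (H := exp_pos (Rabs (Re z))); lra).
assert (Hd : 0 < Rmin 1 (eps / K)).
{ apply Rmin_pos; [lra|]. apply Rdiv_lt_0_compat; [apply cond_pos|easy]. }
exists (mkposreal _ Hd); intros y Hy.
change (Cmod (y - z) < Rmin 1 (eps / K)) in Hy.
change (Cmod (logmoment j y - logmoment j z - (y - z) * logmoment (S j) z)%C <= eps * Cmod (y - z)).
assert (H1 := Rmin_l 1 (eps / K)). assert (H2 := Rmin_r 1 (eps / K)).
set (h := (y - z)%C) in *.
replace y with (z + h)%C by (unfold h; ring).
clearbody h; clear y.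
assert (Hh := Rmax_Cmod h).
assert (Hp := Rmax_l (Rabs (fst h)) (Rabs (snd h))).
assert (Hq := Rmax_r (Rabs (fst h)) (Rabs (snd h))).
assert (Hn : fst h ^ 2 + snd h ^ 2 = Cmod h ^ 2).
{ unfold Cmod; rewrite pow2_sqrt; [easy|]. apply Rplus_le_le_0_compat; apply pow2_ge_0. }
destruct z as [a b], h as [p q]; cbn [fst snd Re Im] in *.
assert (B := fun t Ht => exp_increment_bound a b p q t Ht ltac:(lra) ltac:(lra)).
rewrite Hn in B.
apply Rle_trans with (1 := Cmod_le_Rabs _).
set (N := Cmod (p, q)) in *.
apply Rle_trans with (8 * (8 * exp (Rabs a) * N ^ 2) + 8 * (8 * exp (Rabs a) * N ^ 2)).
- apply Rplus_le_compat.
  + rewrite <- (logint_pow_lin j (ecos ((a, b) + (p, q))%C) (ecos (a, b)) (ecos (a, b)) (esin (a, b)) p (- q)).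
    2-5: intros; apply continuous_ecos || apply continuous_esin.
    2:{ intros t Ht. replace (p * ecos (a, b) t + - q * esin (a, b) t) with (p * ecos (a, b) t - q * esin (a, b) t) by ring. apply (B t Ht). }
    right; f_equal; cbn [logmoment Cminus Cplus Cmult Copp fst snd]; ring.
  + rewrite <- (logint_pow_lin j (esin ((a, b) + (p, q))%C) (esin (a, b)) (esin (a, b)) (ecos (a, b)) p q).
    2-5: intros; apply continuous_ecos || apply continuous_esin.
    2:{ intros t Ht. apply (B t Ht). }
    right; f_equal; cbn [logmoment Cminus Cplus Cmult Copp fst snd]; ring.
- assert (HN : 0 <= N) by apply Cmod_ge_0.
  assert (N * K <= eps).
  { apply Rle_trans with (eps / K * K); [apply Rmult_le_compat_r; lra|right; field; lra]. }
  replace (_ + _) with (N * (N * K)) by (unfold K; ring).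
  rewrite (Rmult_comm eps). now apply Rmult_le_compat_l.
Qed.

(** * The bracketed function as a logarithmic moment *)

Lemma is_RInt_Cmult (c : C) (f : R -> C) (a b : R) (l : C) :
  is_RInt (V := C_R_NormedModule) f a b l ->
  is_RInt (V := C_R_NormedModule) (fun u => c * f u)%C a b (c * l)%C.
Proof.
intros H.
assert (H1 := is_RInt_fct_extend_fst (U := R_NormedModule) (V := R_NormedModule) f a b l H).
assert (H2 := is_RInt_fct_extend_snd (U := R_NormedModule) (V := R_NormedModule) f a b l H).
apply (is_RInt_fct_extend_pair (U := R_NormedModule) (V := R_NormedModule)).
- apply (is_RInt_minus (V := R_NormedModule)); apply (is_RInt_scal (V := R_NormedModule)); easy.
- apply (is_RInt_plus (V := R_NormedModule)); apply (is_RInt_scal (V := R_NormedModule)); easy.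
Qed.

(** [is_RInt_quot] applied to the real and imaginary parts of [exp(z u) - 1], whose derivative in
    the real variable [u] is [z exp(z u)]. *)
Lemma is_RInt_Cexp_quot (z : C) :
  is_RInt (V := C_R_NormedModule) (fun u : R => (Cexp (u * z) - 1) / u)%C 0 1
    (- (z * logmoment 0 z))%C.
Proof.
destruct z as [a b].
assert (Hc : forall (c : R) (f : R -> R), (forall t, continuous f t) -> forall t, continuous (fun t => c * f t) t).
{ intros c f Hf t; apply (continuous_scal_r c f), Hf. }
assert (H1 : is_RInt (fun u => (ecos (a, b) u - 1) / u) 0 1
   (- logint (fun t => a * ecos (a, b) t + - b * esin (a, b) t))).
{ apply (is_RInt_quot (fun u => ecos (a, b) u - 1)).
  - intros t; unfold ecos, esin; cbn; auto_derive; auto; ring.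
  - intros t; apply (continuous_plus (fun t => a * ecos (a, b) t)); apply Hc; intros;
      apply continuous_ecos || apply continuous_esin.
  - unfold ecos; rewrite !Rmult_0_r, exp_0, cos_0; ring. }
assert (H2 : is_RInt (fun u => esin (a, b) u / u) 0 1
   (- logint (fun t => a * esin (a, b) t + b * ecos (a, b) t))).
{ apply (is_RInt_quot (fun u => esin (a, b) u)).
  - intros t; unfold ecos, esin; cbn; auto_derive; auto; ring.
  - intros t; apply (continuous_plus (fun t => a * esin (a, b) t)); apply Hc; intros;
      apply continuous_ecos || apply continuous_esin.
  - unfold esin; rewrite !Rmult_0_r, sin_0; ring. }
rewrite logint_plus, !logint_scal in H1, H2;
  try (intros; try apply Hc; intros; apply continuous_ecos || apply continuous_esin).
assert (E : forall f, logint (fun t => t ^ 0 * f t) = logint f).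
{ intros f; apply logint_ext; intros; cbn; ring. }
replace (- ((a, b) * logmoment 0 (a, b)))%C with
  (- (a * logint (ecos (a, b)) + - b * logint (esin (a, b))),
   - (a * logint (esin (a, b)) + b * logint (ecos (a, b)))).
2:{ unfold logmoment; rewrite !E; unfold Cmult, Copp; cbn [fst snd]; f_equal; ring. }
apply (is_RInt_fct_extend_pair (U := R_NormedModule) (V := R_NormedModule)).
- apply (is_RInt_ext (V := R_NormedModule) (fun u => (ecos (a, b) u - 1) / u)); [|exact H1].
  rewrite Rmin_left, Rmax_right by lra; intros u Hu.
  unfold ecos; cbn; rewrite !Rmult_0_l, Rminus_0_r, !Rplus_0_r, Rmult_1_r, (Rmult_comm u a), (Rmult_comm u b).
  field; lra.
- apply (is_RInt_ext (V := R_NormedModule) (fun u => esin (a, b) u / u)); [|exact H2].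
  rewrite Rmin_left, Rmax_right by lra; intros u Hu.
  unfold esin; cbn; rewrite !Rmult_0_l, Rminus_0_r, !Rplus_0_r, Rmult_1_r, (Rmult_comm u a), (Rmult_comm u b).
  field; lra.
Qed.

(** The logarithm and Euler's constant cancel. The hyperbolic integrals are half sum and half
    difference of the exponential ones at [z] and [-z], so in their sum the part at [-z] cancels. *)
Lemma bracket_logmoment (lg : C -> C) (z : C) : z <> 0%C -> bracket lg z = logmoment 0 z.
Proof.
intros Hz.
assert (H2 : (2 : C) <> 0%C) by (intros E; apply RtoC_inj in E; lra).
assert (Hp := is_RInt_Cexp_quot z).
assert (Hm := is_RInt_Cexp_quot (- z)%C).
assert (HC : RInt (V := C_R_CompleteNormedModule)
    (fun u : R => (Ccosh (u * z) - 1) / (u * z))%C 0 1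
  = (/ (2 * z) * (- (z * logmoment 0 z) + - (- z * logmoment 0 (- z))))%C).
{ apply is_RInt_unique.
  apply (is_RInt_ext (V := C_R_NormedModule)
    (fun u : R => / (2 * z) * ((Cexp (u * z) - 1) / u + (Cexp (u * - z) - 1) / u))%C);
    [|exact (is_RInt_Cmult _ _ _ _ _ (is_RInt_plus _ _ _ _ _ _ Hp Hm))].
  rewrite Rmin_left, Rmax_right by lra; intros u Hu.
  assert (Hu0 : (u : C) <> 0%C) by (intros E; apply RtoC_inj in E; lra).
  unfold Ccosh. replace (- (u * z))%C with (u * - z)%C by ring.
  match goal with |- ?v = ?w => change (@eq C v w) end. field; auto. }
assert (HS : RInt (V := C_R_CompleteNormedModule)
    (fun u : R => Csinh (u * z) / (u * z))%C 0 1
  = (/ (2 * z) * (- (z * logmoment 0 z) - - (- z * logmoment 0 (- z))))%C).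
{ apply is_RInt_unique.
  apply (is_RInt_ext (V := C_R_NormedModule)
    (fun u : R => / (2 * z) * ((Cexp (u * z) - 1) / u - (Cexp (u * - z) - 1) / u))%C);
    [|exact (is_RInt_Cmult _ _ _ _ _ (is_RInt_minus _ _ _ _ _ _ Hp Hm))].
  rewrite Rmin_left, Rmax_right by lra; intros u Hu.
  assert (Hu0 : (u : C) <> 0%C) by (intros E; apply RtoC_inj in E; lra).
  unfold Csinh. replace (- (u * z))%C with (u * - z)%C by ring.
  match goal with |- ?v = ?w => change (@eq C v w) end. field; auto. }
unfold bracket, Chi, Shi, CInt0; rewrite HC, HS.
field; auto.
Qed.

Lemma bracket_ext_logmoment (lg : C -> C) : bracket_ext lg = logmoment 0.
Proof.
apply functional_extensionality; intros z; unfold bracket_ext.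
destruct (Ceq_dec z 0) as [->|Hz]; [|now apply bracket_logmoment].
assert (L : filterlim (bracket lg) (locally' (RtoC 0 : C_UniformSpace))
              (locally (logmoment 0 (RtoC 0) : C_UniformSpace))).
{ apply filterlim_ext_loc with (logmoment 0).
  - exists (mkposreal 1 Rlt_0_1); intros y _ Hy; symmetry; now apply bracket_logmoment.
  (* A complex derivative gives continuity for the modulus neighbourhoods; [locally_C] identifies
     them with the coordinate ones used by [Clim]. *)
  - assert (K := ex_derive_continuous (K := C_AbsRing) (V := C_NormedModule) (logmoment 0) (RtoC 0)
       (ex_intro _ _ (is_derive_logmoment 0 (RtoC 0)))).
    intros P HP; apply K in HP.
    apply locally_C in HP. unfold filtermap, locally', within in *.
    revert HP; apply filter_imp; auto. }
unfold Clim; apply (iota_unique (V := C_CompleteNormedModule)); [|exact L].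
(* Every full limit equals the value of [C_lim], so two of them coincide. *)
intros y Hy; rewrite <- (is_C_lim_unique _ _ _ Hy); now apply is_C_lim_unique.
Qed.

(** * Iterated derivatives and the binomial sum *)

Lemma Cderiv_n_logmoment (n j : nat) : Cderiv_n n (logmoment j) = logmoment (n + j).
Proof.
induction n as [|n IH]; [easy|].
change (Cderiv (Cderiv_n n (logmoment j)) = logmoment (S n + j)); rewrite IH.
apply functional_extensionality; intros z.
assert (D := is_derive_logmoment (n + j) z).
unfold Cderiv; apply (iota_unique (V := C_CompleteNormedModule)); [|exact D].
intros y Hy; rewrite <- (is_C_derive_unique _ _ _ Hy); now apply is_C_derive_unique.
Qed.

Lemma logmoment_RtoC (j : nat) (x : R) :
  logmoment j x = RtoC (logint (fun t => t ^ j * exp (x * t))).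
Proof.
unfold logmoment, RtoC; f_equal.
- apply logint_ext; intros t; unfold ecos; cbn -[pow]; rewrite Rmult_0_l, cos_0; ring.
- rewrite (logint_ext _ (fun t => 0 * 0)), logint_scal; [ring|intros; apply continuous_const|].
  intros t; unfold esin; cbn -[pow]; rewrite Rmult_0_l, sin_0; ring.
Qed.

(** The two claims share one induction, since additivity of [logint] at each step needs continuity
    of the partial sum. *)
Lemma logint_sum_n (f : nat -> R -> R) (k : nat) :
  (forall n t, continuous (f n) t) ->
  (forall t, continuous (fun t => sum_n (fun n => f n t) k) t) /\
  logint (fun t => sum_n (fun n => f n t) k) = sum_n (fun n => logint (f n)) k.
Proof.
intros Hf; induction k as [|k [IHc IH]].
- split.
  + intros t; apply continuous_ext with (f O); [|apply Hf]. intros; now rewrite sum_O.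
  + rewrite sum_O; apply logint_ext; intros; now rewrite sum_O.
- split.
  + intros t; apply continuous_ext with (fun t => plus (sum_n (fun n => f n t) k) (f (S k) t)).
    { intros; now rewrite sum_Sn. }
    now apply (continuous_plus (fun t => sum_n (fun n => f n t) k)).
  + rewrite sum_Sn, <- IH. etransitivity; [|exact (logint_plus _ _ IHc (Hf (S k)))].
    apply logint_ext; intros; now rewrite sum_Sn.
Qed.

Lemma pow_1_sub (t : R) (k : nat) :
  (1 - t) ^ k = sum_n (fun n => (-1) ^ n * Binomial.C k n * t ^ n) k.
Proof.
replace (1 - t) with (- t + 1) by ring.
rewrite binomial, <- sum_n_Reals; apply sum_n_ext; intros n.
match goal with |- ?v = ?w => change (@eq R v w) end.
replace (- t) with ((-1) * t) by ring; rewrite pow1, Rpow_mult_distr; ring.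
Qed.

Lemma continuous_exp_scal (x t : R) : continuous (fun t => exp (x * t)) t.
Proof. apply (ex_derive_continuous (fun t => exp (x * t))); auto_derive; auto. Qed.

Lemma RtoC_sum_n (f : nat -> R) (k : nat) :
  RtoC (sum_n f k) = sum_n (fun n => RtoC (f n)) k.
Proof.
induction k as [|k IH]; [now rewrite !sum_O|].
rewrite !sum_Sn, <- IH; apply RtoC_plus.
Qed.

Lemma calF_logint (lg : C -> C) (s k : Z) (x : R) : (0 <= k)%Z -> (s <= k)%Z ->
  calF lg s k x =
  RtoC (logint (fun t => exp (x * t) * t ^ Z.to_nat (k - s) * (1 - t) ^ Z.to_nat k)).
Proof.
intros Hk Hs.
set (f := fun n t => ((-1) ^ n * Binomial.C (Z.to_nat k) n)
   * (t ^ (n + Z.to_nat (k - s)) * exp (x * t))).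
assert (Hf : forall n t, continuous (f n) t).
{ intros n t. apply (continuous_scal_r _ (fun t => t ^ (n + Z.to_nat (k - s)) * exp (x * t))).
  apply continuous_pow_mult, continuous_exp_scal. }
rewrite (logint_ext _ (fun t => sum_n (fun n => f n t) (Z.to_nat k))).
2:{ intros t; rewrite pow_1_sub.
    rewrite <- (sum_n_mult_l (K := R_Ring)); apply sum_n_ext; intros n.
    match goal with |- ?v = ?w => change (@eq R v w) end.
    unfold f, mult; cbn -[pow Z.to_nat]; rewrite pow_add; ring. }
rewrite (proj2 (logint_sum_n f _ Hf)).
unfold calF; rewrite bracket_ext_logmoment.
rewrite RtoC_sum_n; apply sum_n_ext; intros n; unfold f.
rewrite logint_scal by (intros; apply continuous_pow_mult, continuous_exp_scal).
rewrite Cderiv_n_logmoment, logmoment_RtoC, Nat.add_0_r.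
rewrite !RtoC_mult, RtoC_pow.
(* [s <= k] keeps [k - s] nonnegative, so the conversion to [nat] splits without truncation. *)
now replace (Z.to_nat (Z.of_nat n + k - s)) with (n + Z.to_nat (k - s))%nat by lia.
Qed.

(** * The improper integral against [ln ((1 - t) / t)] *)

Definition logprim (f : R -> R) (s : R) : R := RInt (logker f) 0 s.

Lemma is_derive_logprim (f : R -> R) (s : R) :
  (forall t, continuous f t) -> is_derive (logprim f) s (logker f s).
Proof.
intros Hf; apply (is_derive_RInt (logker f) (logprim f) 0); [|now apply continuous_logker].
apply filter_forall; intros y.
apply (RInt_correct (logker f)), (ex_RInt_continuous (logker f)).
intros; now apply continuous_logker.
Qed.

(** [logprim f (sqrt t)] stands for the integral of [f * ln] from 0 to [t]. By the chain rule the
    weight becomes [4 sqrt t ln (sqrt t) / (2 sqrt t) = ln t]. *)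
Lemma is_derive_logprim_sqrt (f : R -> R) (t : R) : 0 < t ->
  (forall t, continuous f t) -> is_derive (fun t => logprim f (sqrt t)) t (f t * ln t).
Proof.
intros Ht Hf.
assert (Hs : 0 < sqrt t) by now apply sqrt_lt_R0.
assert (Hss := sqrt_sqrt t (Rlt_le _ _ Ht)).
assert (D := is_derive_logprim f (sqrt t) Hf).
assert (ex_derive (logprim f) (sqrt t)) by now exists (logker f (sqrt t)).
assert (E : Derive (logprim f) (sqrt t) = logker f (sqrt t)) by now apply is_derive_unique.
auto_derive; [auto|].
change (Derive (fun x : R => logprim f x)) with (Derive (logprim f)); rewrite E.
unfold logker; replace (sqrt t ^ 2) with t by (rewrite <- Hss at 1; ring).
assert (L : ln t = 2 * ln (sqrt t)) by (rewrite <- Hss at 1; rewrite ln_mult by easy; ring).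
rewrite L; field; lra.
Qed.

(** Continuity, unlike the derivative formula, reaches [t = 0]; this yields the limits at the
    singular endpoints. *)
Lemma continuous_logprim_sqrt (f : R -> R) (t : R) :
  (forall t, continuous f t) -> continuous (fun t => logprim f (sqrt t)) t.
Proof.
intros Hf; apply (continuous_comp sqrt); [apply continuous_sqrt|].
apply (ex_derive_continuous (logprim f)); eexists; now apply is_derive_logprim.
Qed.

(** The fundamental theorem applies between any two points of []a, b[], and continuity of [F] at [a]
    and [b] gives the limit. *)
Lemma is_RInt_gen_primitive (F f : R -> R) (a b : R) : a < b ->
  (forall t, a < t < b -> is_derive F t (f t)) ->
  (forall t, a < t < b -> continuous f t) ->
  continuous F a -> continuous F b ->
  is_RInt_gen f (at_right a) (at_left b) (F b - F a).
Proof.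
intros Hab HF Hf Ha Hb P HP.
assert (L : filterlim (fun ab : R * R => F (snd ab) - F (fst ab))
   (filter_prod (at_right a) (at_left b)) (locally (F b - F a))).
{ apply (filterlim_comp_2 (G := locally (F b)) (H := locally (F a)) (fun ab : R * R => F (snd ab)) (fun ab => F (fst ab)) Rminus).
  - apply filterlim_comp with (1 := filterlim_snd).
    apply filterlim_filter_le_1 with (2 := Hb). apply filter_le_within.
  - apply filterlim_comp with (1 := filterlim_fst).
    apply filterlim_filter_le_1 with (2 := Ha). apply filter_le_within.
  - apply (filterlim_comp_2 (G := locally (F b)) (H := locally (- F a)) fst (fun p => - snd p) Rplus).
    + apply filterlim_fst.
    + apply filterlim_comp with (1 := filterlim_snd). apply (filterlim_opp (F a)).
    + apply (filterlim_plus (F b) (- F a)). }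
assert (HI : filter_prod (at_right a) (at_left b)
   (fun ab : R * R => a < fst ab < b /\ a < snd ab < b)).
{ assert (H0 : 0 < b - a) by lra.
  apply Filter_prod with (fun t => a < t < b) (fun t => a < t < b).
  - exists (mkposreal _ H0); intros y Hy Hay.
    apply Rabs_lt_between' in Hy; cbn in Hy; lra.
  - exists (mkposreal _ H0); intros y Hy Hay.
    apply Rabs_lt_between' in Hy; cbn in Hy; lra.
  - easy. }
unfold filtermapi.
apply (filter_imp (fun ab : R * R => (a < fst ab < b /\ a < snd ab < b) /\ P (F (snd ab) - F (fst ab))));
  [|now apply filter_and; [|apply (L P HP)]].
intros [u v] [[Hu Hv] HPuv]; cbn [fst snd] in *.
exists (F v - F u); split; [|exact HPuv].
assert (Hm : forall t, Rmin u v <= t <= Rmax u v -> a < t < b).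
{ intros t; unfold Rmin, Rmax; destruct (Rle_dec u v); lra. }
apply (is_RInt_derive F f); auto.
Qed.

Lemma is_RInt_gen_log_ratio (f : R -> R) : (forall t, continuous f t) ->
  is_RInt_gen (fun t => f t * ln ((1 - t) / t)) (at_right 0) (at_left 1)
    (logint (fun t => f (1 - t)) - logint f).
Proof.
intros Hf.
set (g := fun t => f (1 - t)).
assert (Hl : forall t : R, continuous (fun t : R => 1 - t) t).
{ intros t; apply (ex_derive_continuous (fun t : R => 1 - t)); auto_derive; auto. }
assert (Hg : forall t, continuous g t).
{ intros t; apply (continuous_comp (fun t : R => 1 - t)); auto. }
(* A primitive of [f t (ln (1 - t) - ln t)]: the first term is the primitive for [g], reflected by
   [t -> 1 - t]. It gives [F 1 = - logint f] and [F 0 = - logint g]. *)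
set (F := fun t => - logprim g (sqrt (1 - t)) - logprim f (sqrt t)).
assert (HF : forall t, continuous F t).
{ intros t; apply (continuous_minus (fun t => - logprim g (sqrt (1 - t)))).
  - apply (continuous_opp (fun t => logprim g (sqrt (1 - t)))).
    apply (continuous_comp (fun t : R => 1 - t) (fun t => logprim g (sqrt t))); auto.
    now apply continuous_logprim_sqrt.
  - now apply continuous_logprim_sqrt. }
assert (Z : forall h, logprim h 0 = 0) by (intros; apply (RInt_point 0 (logker h))).
replace (logint g - logint f) with (F 1 - F 0).
2:{ unfold F; rewrite Rminus_0_r, Rminus_diag, sqrt_0, sqrt_1, !Z.
    change (logprim g 1) with (logint g); change (logprim f 1) with (logint f); ring. }
apply is_RInt_gen_primitive; auto using Rlt_0_1.
- intros t Ht.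
  assert (D1 := is_derive_logprim_sqrt g (1 - t) ltac:(lra) Hg).
  assert (D2 := is_derive_logprim_sqrt f t ltac:(lra) Hf).
  assert (D3 : is_derive (fun t : R => 1 - t) t (-1)) by (auto_derive; auto; ring).
  assert (D4 := is_derive_comp _ (fun t : R => 1 - t) _ _ _ D1 D3).
  assert (D5 := is_derive_minus _ _ _ _ _ (is_derive_opp _ _ _ D4) D2).
  replace (f t * ln ((1 - t) / t)) with (- ((-1) * (g (1 - t) * ln (1 - t))) - f t * ln t).
  + exact D5.
  + unfold g; replace (1 - (1 - t)) with t by ring; rewrite ln_div by lra; ring.
- intros t Ht; apply (continuous_mult f (fun t => ln ((1 - t) / t))); auto.
  apply (ex_derive_continuous (fun t => ln ((1 - t) / t))); auto_derive.
  repeat split; try lra. apply Rdiv_lt_0_compat; lra.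
Qed.

Theorem theorem15 :
  forall (lg : C -> C), is_Clog lg ->
  forall (l : Z) (m : nat), (l <= Z.of_nat m)%Z ->
  forall x : R,
    ex_RInt_gen (I1_integrand (IZR l / 2) (INR m + (1 - IZR l) / 2) x)
      (at_right 0) (at_left 1) /\
    RtoC (I1 (IZR l / 2) (INR m + (1 - IZR l) / 2) x) =
      (RtoC (exp x) * calF lg (- l) (Z.of_nat m - l) (RtoC (- x))
       - calF lg l (Z.of_nat m) (RtoC x))%C.
Proof.
intros lg _ l m Hlm x.
rewrite !calF_logint by lia.
(* In the first term, [k - s = (m - l) - (- l) = m]. *)
rewrite Nat2Z.id; replace (Z.to_nat (Z.of_nat m - l - - l)) with m by lia.
set (d := Z.to_nat (Z.of_nat m - l)).
assert (Hd : INR d = INR m - IZR l).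
{ unfold d; rewrite INR_IZR_INZ, Z2Nat.id by lia. now rewrite minus_IZR, <- INR_IZR_INZ. }
set (f := fun t => exp (x * t) * t ^ d * (1 - t) ^ m).
assert (Hf : forall t, continuous f t).
{ intros t; apply (ex_derive_continuous f); unfold f; auto_derive; auto. }
assert (H : is_RInt_gen (I1_integrand (IZR l / 2) (INR m + (1 - IZR l) / 2) x)
   (at_right 0) (at_left 1) (logint (fun t => f (1 - t)) - logint f)).
{ apply (is_RInt_gen_ext (fun t => f t * ln ((1 - t) / t))); [|now apply is_RInt_gen_log_ratio].
  assert (H0 : 0 < 1) by lra.
  apply Filter_prod with (fun t => 0 < t < 1) (fun t => 0 < t < 1).
  1,2: exists (mkposreal _ H0); intros y Hy Hay; apply Rabs_lt_between' in Hy; cbn in Hy; lra.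
  intros u v Hu Hv t Ht; cbn [fst snd] in Ht.
  assert (Ht' : 0 < t < 1) by (revert Ht; unfold Rmin, Rmax; destruct (Rle_dec u v); lra).
  unfold I1_integrand, f.
  (* Here [mu - kappa - 1/2 = m - l] and [mu + kappa - 1/2 = m]; [Rpower] agrees with the integer
     power because [t] and [1 - t] are positive. *)
  replace (_ - _ - 1 / 2) with (INR d) by (rewrite Hd; field).
  replace (_ + _ - 1 / 2) with (INR m) by field.
  rewrite !Rpower_pow by lra.
  match goal with |- ?v = ?w => change (@eq R v w) end; ring. }
split; [eexists; exact H|].
unfold I1; rewrite (is_RInt_gen_unique _ _ H), <- RtoC_mult, <- RtoC_minus.
do 2 f_equal.
(* With [exp x] moved inside, the integrands agree pointwise, as
   [exp (x (1 - t)) = exp x * exp (- x t)]. *)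
rewrite <- logint_scal.
2:{ intros t; apply (ex_derive_continuous (fun t => exp (- x * t) * t ^ m * (1 - t) ^ d)).
    auto_derive; auto. }
apply logint_ext; intros t; unfold f.
replace (x * (1 - t)) with (x + - x * t) by ring; rewrite exp_plus.
replace (1 - (1 - t)) with t by ring; ring.
Qed.
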